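(* Let $l\ge1$, let $\kappa=\frac re$ with $r,e$ coprime positive integers, and let $\mathbf s=(s_1,\dots,s_l)\in\mathbb Q^l$ with $rs_j\in\mathbb Z$ for all $j$; put $s=(\kappa,\mathbf s)$. Let $m_j=s_j-\frac{j}{\kappa l}$, $\mathbf m=(m_1,\dots,m_l)$, and let $\mathbf c=(c_1,\dots,c_l)\in\{0,\dots,e-1\}^l$ be defined by $rs_j=ed_j+rc_j$ with $d_j\in\mathbb Z$. Then the colored oriented graph $\mathcal G_s$ is equivalent to the crystal $\mathcal G_{e,\mathbf m,\mathbf c}$. More precisely, the identity map $\boldsymbol\lambda\mapsto\boldsymbol\lambda$ on $l$-partitions together with the bijection $$\psi:\mathbb Z/e\mathbb Z\to I_s,\qquad i\ (\mathrm{mod}\ e)\mapsto i\ (\mathrm{mod}\ \kappa^{-1}\mathbb Z),$$ is an isomorphism of colored oriented graphs from $\mathcal G_{e,\mathbf m,\mathbf c}$ to $\mathcal G_s$: an $l$-partition is a highest weight vertex of $\mathcal G_{e,\mathbf m,\mathbf c}$ if and only if it is a highest weight vertex of $\mathcal G_s$, and $\boldsymbol\lambda\xrightarrow{i}\boldsymbol\mu$ is an arrow of $\mathcal G_{e,\mathbf m,\mathbf c}$ if and only if $\boldsymbol\lambda\xrightarrow{\psi(i)}\boldsymbol\mu$ is an arrow of $\mathcal G_s$.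
   Context: **Multipartitions.** An $l$-partition is an $l$-tuple $\boldsymbol\lambda=(\lambda^1,\dots,\lambda^l)$ of partitions. Its nodes are triples $(a,b,c)$ ($a$ row, $b$ column, $c$ component, $1\le b\le\lambda^c_a$). A node of $\boldsymbol\lambda$ is removable if deleting it leaves an $l$-partition; a triple not in $\boldsymbol\lambda$ is addable if adding it gives an $l$-partition. **Graph attached to residues and orders.** Suppose each node is given a residue in a set $I$ and, for each $l$-partition and each $z\in I$, its addable and removable nodes of residue $z$ are totally ordered. The associated colored oriented graph has all $l$-partitions as vertices and arrows colored by $I$. For $z\in I$, write the addable and removable nodes of residue $z$ of $\boldsymbol\lambda$ in increasing order, encode addable ones by $A$ and removable ones by $R$, and delete subwords $RA$ recursively until a word $A^pR^q$ remains. There is an arrow $\boldsymbol\lambda\xrightarrow{z}\boldsymbol\mu$ iff $p>0$ and $\boldsymbol\mu$ is obtained from $\boldsymbol\lambda$ by adding the node corresponding to the rightmost remaining $A$. A highest weight vertex is one with no incoming arrow. The set $I$ is called the indexing set. **The graph $\mathcal G_s$.** Residue of $(a,b,c)$: the class of $b-a+s_c$ in $\mathbb Q/\kappa^{-1}\mathbb Z$. Indexing set: $I_s=\{x+s_j+\kappa^{-1}\mathbb Z: x\in\mathbb Z,\ 1\le j\le l\}\subset\mathbb Q/\kappa^{-1}\mathbb Z$. Order on addable/removable nodes of equal residue: $(a,b,c)\le(a',b',c')$ iff $\kappa l(b-a+s_c)-c\le\kappa l(b'-a'+s_{c'})-c'$ (this is a total order). **The graph $\mathcal G_{e,\mathbf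 m,\mathbf c}$.** Residue of $(a,b,k)$: $b-a+c_k \bmod e$. Indexing set: $\mathbb Z/e\mathbb Z$. Order on addable/removable nodes of equal residue: $(a,b,k)\prec_{\mathbf m}(a',b',k')$ iff $b-a+m_k<b'-a'+m_{k'}$. This is a total order whenever $c_i-m_i-(c_j-m_j)\notin e\mathbb Z$ for all $i\ne j$, which holds for the present $\mathbf m,\mathbf c$. Two graphs are called equivalent if they are isomorphic via the identity on vertices and a bijection between the indexing sets of colors, with highest weight vertices corresponding to each other. *)

(* Defs.v *)
From HB Require Import structures.
From mathcomp Require Import all_boot all_order all_algebra.
From mathcomp Require Import classical_sets functions.

Set Implicit Arguments.
Unset Strict Implicit.
Unset Printing Implicit Defensive.

Import Order.TTheory GRing.Theory Num.Theory.

Local Open Scope ring_scope.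
Local Open Scope quotient_scope.
Local Open Scope classical_set_scope.

Record int_partition := IntPartition {
  parts :> seq nat;
  partsP : sorted geq parts && (0%N \notin parts) }.

Definition multipartition (l : nat) := l.-tuple int_partition.

(* Rows and columns are numbered from 1.  Components are elements of 'I_l, hence
   numbered from 0; component_number restores the numbering 1, ..., l, which
   matters in the order of G_s and in the definition of m. *)
Definition node (l : nat) := (nat * nat * 'I_l)%type.

Definition node_row l (n : node l) : nat := n.1.1.
Definition node_col l (n : node l) : nat := n.1.2.
Definition node_comp l (n : node l) : 'I_l := n.2.
Definition component_number l (c : 'I_l) : nat := c.+1.

Definition content l (n : node l) : int := (node_col n)%:Z - (node_row n)%:Z.

Definition node_of l (la : multipartition l) (n : node l) : bool :=
  [&& (1 <= node_row n)%N, (1 <= node_col n)%N &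
      (node_col n <= nth 0 (tnth la (node_comp n)) (node_row n).-1)%N].

Definition adds_node l (la : multipartition l) (n : node l)
    (mu : multipartition l) : Prop :=
  ~~ node_of la n /\ forall x, node_of mu x = node_of la x || (x == n).

Definition addable l (la : multipartition l) (n : node l) : Prop :=
  exists mu, adds_node la n mu.

Definition removable l (la : multipartition l) (n : node l) : Prop :=
  exists mu, adds_node mu n la.

Record colored_graph (V : Type) := ColoredGraph {
  color : Type;
  indexing_set : set color;
  arrow : color -> V -> V -> Prop }.

Arguments indexing_set {V} G _ : rename.
Arguments arrow {V} G _ _ _ : rename.

Definition highest_weight V (G : colored_graph V) (v : V) : Prop :=
  forall z u, indexing_set G z -> ~ arrow G z u v.

Definition equivalent_via V (G H : colored_graph V)
    (psi : color G -> color H) : Prop :=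
  [/\ set_bij (indexing_set G) (indexing_set H) psi,
      forall v, highest_weight G v <-> highest_weight H v
    & forall z u v, indexing_set G z ->
        (arrow G z u v <-> arrow H (psi z) u v)].

Definition equivalent V (G H : colored_graph V) : Prop :=
  exists psi : color G -> color H, equivalent_via psi.

(* The order ord may be given in its strict or in its reflexive form: the words
   below have no repetition, so both lead to the same increasing words. *)
Section CrystalArrow.
Variables (l : nat) (K : Type) (res : node l -> K) (ord : rel (node l)).

Definition increasing_word (la : multipartition l) (z : K)
    (w : seq (node l)) : Prop :=
  [/\ uniq w,
      forall n, n \in w <-> (addable la n \/ removable la n) /\ res n = z
    & pairwise ord w].

(* Words are kept as sequences of nodes; the letter of a node is A if it is
   addable to la and R if it is removable from la. *)
Inductive reduces (la : multipartition l) :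
    seq (node l) -> seq (node l) -> Prop :=
  | reduces_refl w : reduces la w w
  | reduces_RA w1 x y w2 w' :
      removable la x -> addable la y ->
      reduces la (w1 ++ w2) w' -> reduces la (w1 ++ [:: x, y & w2]) w'.

(* The reduced word A^p R^q, with p > 0, is written u n v, where n is its
   rightmost A. *)
Definition crystal_arrow (z : K) (la mu : multipartition l) : Prop :=
  exists w u n v,
    [/\ increasing_word la z w,
        reduces la w (u ++ n :: v),
        forall x, x \in rcons u n -> addable la x,
        forall x, x \in v -> removable la x
      & adds_node la n mu].

End CrystalArrow.

(* The subgroup tZ of Q, for t != 0. *)
Definition multZ (t : rat) : {pred rat} := fun x => x / t \is a Num.int.

Lemma multZ_zmod_closed t : zmod_closed (multZ t).
Proof.
split=> [|x y]; rewrite !unfold_in ?mul0r ?rpred0 // mulrBl.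
exact: rpredB.
Qed.

HB.instance Definition _ t :=
  GRing.isZmodClosed.Build rat (multZ t) (multZ_zmod_closed t).

Definition rat_mod (t : rat) := {ideal_quot (multZ t)}.
Definition class_rat (t x : rat) : rat_mod t := \pi_(rat_mod t) x.

(* This is Z/eZ for every e > 0, including the trivial group for e = 1, which
   'Z_1 is not. *)
Definition int_mod (e : nat) := {ideal_quot (dvdz e : {pred int})}.
Definition class_int (e : nat) (i : int) : int_mod e := \pi_(int_mod e) i.

Section GraphGs.
Variables (l : nat) (kappa : rat) (s : 'I_l -> rat).

Definition res_s (n : node l) : rat_mod kappa^-1 :=
  class_rat kappa^-1 ((content n)%:~R + s (node_comp n)).

Definition I_s : set (rat_mod kappa^-1) :=
  [set z | exists (x : int) (j : 'I_l), z = class_rat kappa^-1 (x%:~R + s j)].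

Definition ord_s : rel (node l) := fun n n' =>
  kappa * l%:R * ((content n)%:~R + s (node_comp n))
    - (component_number (node_comp n))%:R
  <= kappa * l%:R * ((content n')%:~R + s (node_comp n'))
    - (component_number (node_comp n'))%:R.

Definition graph_s : colored_graph (multipartition l) :=
  {| indexing_set := I_s; arrow := crystal_arrow res_s ord_s |}.

End GraphGs.

Section GraphGemc.
Variables (l e : nat) (m : 'I_l -> rat) (c : 'I_l -> int).

Definition res_emc (n : node l) : int_mod e :=
  class_int e (content n + c (node_comp n)).

Definition ord_m : rel (node l) := fun n n' =>
  (content n)%:~R + m (node_comp n) < (content n')%:~R + m (node_comp n').

Definition graph_emc : colored_graph (multipartition l) :=
  {| indexing_set := [set: int_mod e]; arrow := crystal_arrow res_emc ord_m |}.

End GraphGemc.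

(* Main.v *)
(* Since s_j = c_j + d_j / kappa, the map psi carries the residue of a node in
   G_(e,m,c) to its residue in G_s; it is injective on Z/eZ because r and e are
   coprime.  The quantity ordering the nodes in G_s is kappa * l times the one
   in G_(e,m,c), so the two orders agree up to ties.  Two nodes of the same
   residue with a tie lie in the same component and on the same diagonal, as
   kappa * l times the difference of their shifted contents is both a multiple
   of l and a difference of two component numbers; and a diagonal of a partition
   contains at most one addable or removable node. *)
Require Import Defs.
From HB Require Import structures.
From mathcomp Require Import all_boot all_order all_algebra.
From mathcomp Require Import classical_sets functions.
From mathcomp Require Import zify ring.
Set Implicit Arguments.
Unset Strict Implicit.
Unset Printing Implicit Defensive.
Import Order.TTheory GRing.Theory Num.Theory.
Local Open Scope ring_scope.

Lemma nth_part_anti (p : int_partition) (i j : nat) :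
  (i <= j)%N -> (nth 0 p j <= nth 0 p i)%N.
Proof.
move=> le_ij; have /andP[p_sorted _] := partsP p.
(* Past the last part the default [0] is the length of an empty row. *)
have [lt_j|le_j] := ltnP j (size p); last by rewrite nth_default.
apply: (sorted_leq_nth _ _ 0%N p_sorted) => //; rewrite ?inE //.
- by move=> x y z /= le1 le2; apply: leq_trans le2 le1.
- by move=> x /=.
- exact: leq_ltn_trans lt_j.
Qed.

Lemma node_of_le l (la : multipartition l) (a a' b b' : nat) (k : 'I_l) :
  (0 < a <= a')%N -> (0 < b <= b')%N ->
  node_of la (a', b', k) -> node_of la (a, b, k).
Proof.
rewrite /node_of /node_row /node_col /node_comp /=.
move=> /andP[a_gt0 le_a] /andP[b_gt0 le_b] /and3P[_ _ b'_le].
rewrite a_gt0 b_gt0 (leq_trans le_b) // (leq_trans b'_le) //.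
by apply: nth_part_anti; lia.
Qed.

(** If [a < a'], the second node lies strictly south-east of the first, which forces [(a, b.+1, k)]
    into [la]. Then [(a, b, k)] must be in [la], so it is not addable, and deleting it would leave a
    gap in its row, so it is not removable. *)
Lemma addable_removable_diag_row l (la : multipartition l) (a b a' b' : nat)
    (k : 'I_l) :
  addable la (a, b, k) \/ removable la (a, b, k) ->
  addable la (a', b', k) \/ removable la (a', b', k) ->
  (b + a' = b' + a)%N -> (a' <= a)%N.
Proof.
move=> xAR yAR diag; rewrite leqNgt; apply/negP => lt_a.
have /andP[a_gt0 b_gt0] : (0 < a)%N && (0 < b)%N.
  have gt0 (mu : multipartition l) :
      node_of mu (a, b, k) -> (0 < a)%N && (0 < b)%N.
    by case/and3P=> /= ? ? _; apply/andP.
  case: xAR => -[mu [_ ladd]]; [apply: (gt0 mu)|apply: (gt0 la)];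
  by rewrite ladd eqxx orbT.
have la_z : node_of la (a, b.+1, k).
  case: yAR => -[mu [Ny ladd]].
    have: node_of mu (a, b.+1, k).
      by apply: (@node_of_le _ _ _ a' _ b'); rewrite ?ladd ?eqxx ?orbT //; lia.
    by rewrite ladd => /orP[//|/eqP[]]; lia.
  by apply: (@node_of_le _ _ _ a' _ b'); rewrite ?ladd ?eqxx ?orbT //; lia.
have closed (nu : multipartition l) :
    node_of nu (a, b.+1, k) -> node_of nu (a, b, k).
  by apply: node_of_le; rewrite ?a_gt0 ?b_gt0 /=.
case: xAR => -[mu [/negP Nx ladd]]; first exact/Nx/closed.
by apply/Nx/closed; move: la_z; rewrite ladd => /orP[//|/eqP[]]; lia.
Qed.

Lemma addable_removable_content_inj l (la : multipartition l) (x y : node l) :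
  addable la x \/ removable la x -> addable la y \/ removable la y ->
  node_comp x = node_comp y -> content x = content y -> x = y.
Proof.
case: x y => [[a b] k] [[a' b'] k']; rewrite /content /node_row /node_col /=.
move=> xAR yAR /= eq_k; rewrite /= in eq_k; move: yAR; rewrite -eq_k => yAR diag.
have le1 := addable_removable_diag_row xAR yAR.
have le2 := addable_removable_diag_row yAR xAR.
have [-> ->] : a = a' /\ b = b' by lia.
by [].
Qed.

Section CrystalArrowEq.
Variables (l : nat) (K K' : Type) (res : node l -> K) (res' : node l -> K').
Variables (ord ord' : rel (node l)) (z : K) (z' : K').
Variable la : multipartition l.
Let AR x := addable la x \/ removable la x.
Hypothesis eq_res : forall x, res x = z <-> res' x = z'.
Hypothesis eq_ord : forall x y, AR x -> AR y -> res x = z -> res y = z ->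
  x != y -> ord x y = ord' x y.

Lemma increasing_word_eq w :
  increasing_word res ord la z w <-> increasing_word res' ord' la z' w.
Proof.
have wE : (forall n, n \in w <-> AR n /\ res n = z) <->
          (forall n, n \in w <-> AR n /\ res' n = z').
  by split=> H n; rewrite H eq_res.
have ordE : uniq w -> (forall n, n \in w <-> AR n /\ res n = z) ->
    pairwise ord w = pairwise ord' w.
  move=> w_uniq memw; rewrite uniq_pairwise in w_uniq.
  (* Entries of a duplicate-free word are pairwise distinct, so intersecting with [x != y] is
     harmless; this lets a strict order be compared with a reflexive one. *)
  transitivity (pairwise (fun x y => (x != y) && ord x y) w).
    by rewrite pairwise_relI w_uniq.
  transitivity (pairwise (fun x y => (x != y) && ord' x y) w); last first.
    by rewrite pairwise_relI w_uniq.
  apply: (@eq_in_pairwise _ (mem w)); last exact/allP.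
  move=> x y /memw[ARx rx] /memw[ARy ry].
  by case: eqVneq => //= neq; apply: eq_ord.
split=> -[w_uniq memw incr]; split=> //; try exact/wE.
  by rewrite -ordE.
by rewrite ordE //; apply/wE.
Qed.

Lemma crystal_arrow_eq mu :
  crystal_arrow res ord z la mu <-> crystal_arrow res' ord' z' la mu.
Proof.
by split=> -[w [u [n [v [wP ? ? ? ?]]]]]; exists w, u, n, v; split=> //;
  apply/increasing_word_eq.
Qed.

End CrystalArrowEq.

Section ColoredGraphs.
Variable V : Type.

(** Surjectivity of [psi] onto the colors of [H] pulls every incoming arrow in [H] back to one in
    [G], which gives the highest weight clause. *)
Lemma equivalent_via_arrows (G H : colored_graph V) (psi : color G -> color H) :
  set_bij (indexing_set G) (indexing_set H) psi ->
  (forall z u v, indexing_set G z ->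
    (arrow G z u v <-> arrow H (psi z) u v)) ->
  equivalent_via psi.
Proof.
move=> psi_bij arrowE; split=> // v; have [psi_fun _ psi_surj] := psi_bij.
split=> hw z u Iz.
  have [y Iy <-] := psi_surj _ Iz.
  by move=> uv; apply: (hw y u Iy); apply/arrowE.
by move=> /(arrowE _ _ _ Iz) uv; apply: (hw _ u (psi_fun _ Iz)).
Qed.

(** The color [z0] only serves as the default value of the partial inverse outside the image. *)
Lemma equivalent_via_sym (G H : colored_graph V) (psi : color G -> color H) :
  color G -> equivalent_via psi -> equivalent H G.
Proof.
move=> z0 [psi_bij hwE arrowE].
exists ('pinv_(fun=> z0) (indexing_set G) psi).
have pinv_bij := bijpinv_bij (fun=> z0) psi_bij.
apply: equivalent_via_arrows => // z u v Iz.
have [pinv_fun _ _] := pinv_bij.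
rewrite arrowE; last exact: pinv_fun.
rewrite pinvK // inE; have [_ _ psi_surj] := psi_bij.
exact: psi_surj.
Qed.

End ColoredGraphs.

Lemma class_intE (e : nat) (i j : int) :
  class_int e i = class_int e j <-> (e %| i - j)%Z.
Proof. by rewrite /class_int Quotient.idealrBE; split=> /eqP. Qed.

Lemma class_ratE (t x y : rat) :
  class_rat t x = class_rat t y <-> (x - y) / t \is a Num.int.
Proof.
rewrite -[_ \is a _]/(x - y \in multZ t) /class_rat Quotient.idealrBE.
by split=> /eqP.
Qed.

Lemma intr_mul_frac_int (r e : nat) (i : int) : (0 < e)%N -> coprime r e ->
  (i%:~R * (r%:R / e%:R) : rat) \is a Num.int = (e %| i)%Z.
Proof.
move=> e_gt0 co_re; have e_neq0 : e%:R != 0 :> rat by rewrite pnatr_eq0; lia.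
apply/idP/idP.
  case/intrP=> k eq_k.
  have {}eq_k : i * r%:Z = k * e%:Z.
    apply: (@intr_inj rat); rewrite !intrM -!pmulrn -eq_k.
    by field.
  have : (e %| i * r%:Z)%Z by rewrite eq_k dvdz_mull.
  (* Coprimality cancels [r] from [i * r]. *)
  by rewrite Gauss_dvdzl // coprimezE /= coprime_sym.
case/dvdzP=> k ->; rewrite intrM -pmulrn.
have -> : k%:~R * e%:R * (r%:R / e%:R) = (k * r%:Z)%:~R :> rat.
  by rewrite intrM -pmulrn; field.
exact: intr_int.
Qed.

Theorem proposition4p5 (l r e : nat) (kappa : rat)
    (s m : 'I_l -> rat) (c d : 'I_l -> int)
    (l_ge1 : (1 <= l)%N) (r_gt0 : (0 < r)%N) (e_gt0 : (0 < e)%N)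
    (co_re : coprime r e) (def_kappa : kappa = r%:R / e%:R)
    (rs_int : forall j, r%:R * s j \is a Num.int)
    (def_m : forall j, m j = s j - (component_number j)%:R / (kappa * l%:R))
    (c_range : forall j, 0 <= c j <= e%:Z - 1)
    (def_c : forall j, r%:R * s j = e%:R * (d j)%:~R + r%:R * (c j)%:~R) :
  equivalent (graph_s kappa s) (graph_emc e m c) /\
  exists psi : int_mod e -> rat_mod kappa^-1,
    (forall i : int, psi (class_int e i) = class_rat kappa^-1 i%:~R) /\
    @equivalent_via _ (graph_emc e m c) (graph_s kappa s) psi.
Proof.
have r_neq0 : r%:R != 0 :> rat by rewrite pnatr_eq0; lia.
have e_neq0 : e%:R != 0 :> rat by rewrite pnatr_eq0; lia.
have l_neq0 : l%:R != 0 :> rat by rewrite pnatr_eq0; lia.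
have kappa_gt0 : 0 < kappa by rewrite def_kappa divr_gt0 // ltr0n.
have kappa_neq0 : kappa != 0 by rewrite gt_eqF.
have kl_gt0 : 0 < kappa * l%:R by rewrite mulr_gt0 // ltr0n.
have sE j : s j = (c j)%:~R + (d j)%:~R / kappa.
  by apply: (mulfI r_neq0); rewrite def_c def_kappa; field; apply/andP.
(* One direction makes [psi] independent of the representative, the other makes it injective. *)
have classE i j : class_rat kappa^-1 i%:~R = class_rat kappa^-1 j%:~R <->
    class_int e i = class_int e j.
  rewrite class_ratE class_intE invrK -intrB def_kappa.
  by rewrite (intr_mul_frac_int _ e_gt0 co_re).
have class_s (i : int) j : class_rat kappa^-1 (i%:~R + s j) =
    class_rat kappa^-1 (i + c j)%:~R.
  apply/class_ratE; rewrite invrK sE.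
  have -> : (i%:~R + ((c j)%:~R + (d j)%:~R / kappa) - (i + c j)%:~R) * kappa
      = (d j)%:~R by rewrite intrD; field.
  exact: intr_int.
pose psi (z : int_mod e) := class_rat kappa^-1 (generic_quotient.repr z)%:~R.
have psiE i : psi (class_int e i) = class_rat kappa^-1 i%:~R.
  by apply/classE; rewrite /class_int generic_quotient.reprK.
have intP (z : int_mod e) : exists i, z = class_int e i.
  by exists (generic_quotient.repr z); rewrite /class_int generic_quotient.reprK.
have psi_inj : injective psi.
  by move=> z z'; have [[i ->] [j ->]] := (intP z, intP z'); rewrite !psiE classE.
have res_psi n : psi (res_emc e c n) = res_s kappa s n.
  by rewrite psiE /res_s class_s.
have psi_bij : set_bij [set: int_mod e] (@I_s l kappa s) psi.
  split.
  - move=> z _; have [i ->] := intP z; rewrite psiE.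
    (* Any component would do; [l_ge1] supplies the first. Subtracting its [c] compensates for the
       shift by [s]. *)
    exists (i - c (Ordinal l_ge1)), (Ordinal l_ge1).
    by rewrite class_s subrK.
  - by move=> z z' _ _; apply: psi_inj.
  - by move=> _ [i [j ->]]; exists (class_int e (i + c j)); rewrite // psiE class_s.
have tie_inj (la : multipartition l) (x y : node l) :
    addable la x \/ removable la x -> addable la y \/ removable la y ->
    res_emc e c x = res_emc e c y ->
    (content x)%:~R + m (node_comp x) = (content y)%:~R + m (node_comp y) ->
    x = y.
  move=> ARx ARy /class_intE/dvdzP[q eq_q] tie.
  set kx := node_comp x in eq_q tie *; set ky := node_comp y in eq_q tie *.
  (* Multiply the tie by [kappa * l]: the content and [c] terms differ by [q * e], and
     [e * kappa = r], while each [d j / kappa] contributes [l * d j]. *)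
  have num_diff : (component_number kx)%:Z - (component_number ky)%:Z =
      l%:Z * (q * r%:Z + d kx - d ky).
    apply: (@intr_inj rat); rewrite !(intrB, intrD, intrM) -!pmulrn.
    have {}eq_q : (content x)%:~R + (c kx)%:~R - ((content y)%:~R + (c ky)%:~R)
        = q%:~R * e%:R :> rat.
      by rewrite -!intrD -intrB eq_q intrM -pmulrn.
    have qr : q%:~R * r%:R = q%:~R * e%:R * kappa :> rat.
      by rewrite def_kappa; field.
    rewrite qr -eq_q; move: tie; rewrite !def_m !sE => tie.
    apply/eqP; rewrite -subr_eq0; apply/eqP.
    move/eqP: tie; rewrite -subr_eq0 => /eqP/(congr1 ( *%R (- (kappa * l%:R)))).
    rewrite mulr0 => <-; field.
    by rewrite kappa_neq0 l_neq0.
  have eq_k : kx = ky.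
    apply: val_inj => /=.
    have := ltn_ord kx; have := ltn_ord ky; move: num_diff.
    rewrite /component_number.
    set q' : int := q * _ + _ - _; clearbody q' => num_diff lt_y lt_x.
    (* Component numbers lie between 1 and [l], so their difference is a multiple of [l] only when
       it is zero. *)
    by case: (ltrgtP q' 0) => ?; nia.
  apply: (addable_removable_content_inj ARx ARy) => //.
  move: tie; rewrite eq_k => /addIr; exact: intr_inj.
have equiv : @equivalent_via _ (graph_emc e m c) (graph_s kappa s) psi.
  apply: equivalent_via_arrows => //= z la mu _.
  apply: crystal_arrow_eq => [x|x y ARx ARy rx ry neq_xy].
    by rewrite -res_psi; split=> [->|/psi_inj].
  rewrite /ord_m /ord_s.
  have keyE n : kappa * l%:R * ((content n)%:~R + s (node_comp n)) -
      (component_number (node_comp n))%:R =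
      kappa * l%:R * ((content n)%:~R + m (node_comp n)).
    by rewrite def_m; field; rewrite kappa_neq0 l_neq0.
  (* After cancelling the positive factor, [<] and [<=] can differ only at a tie, which [tie_inj]
     excludes for distinct nodes. *)
  rewrite !keyE ler_pM2l // lt_neqAle.
  case: eqP => //= tie; case/eqP: neq_xy.
  by apply: (tie_inj _ _ _ ARx ARy) => //; rewrite rx ry.
split; last by exists psi.
exact: (equivalent_via_sym (class_int e 0 : color (graph_emc e m c)) equiv).
Qed.
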